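(* Let $f:\mathbb{R}^n\to\mathbb{R}$ be continuously differentiable, let $r>0$, and let $x^\star\in\mathbb{R}^n$ satisfy $\nabla f(x^\star)=0$. Assume: (A1) $\nabla f$ is Lipschitz continuous on $\mathbb{R}^n$ with constant $L>0$; (A2) $f$ is $\mu$-strongly convex on $\mathbb{B}_r(x^\star)$ for some $\mu>0$; (A3) the Hessian $\nabla^2 f$ exists and is Lipschitz continuous on $\mathbb{B}_r(x^\star)$. Let $m\ge1$ be an integer, let $x^0,\dots,x^{m+1}$ be generated by Algorithm AA-R (see context) with memory parameter $m$, starting from a point $x^0$ at which $\nabla^2 f(x^0)$ exists, and suppose there is $M>0$ such that $\kappa(X_k^\top X_k)\le M^2$ for $k=1,\dots,m$. Define $$A=\nabla^2 f(x^0)+E_m,\qquad E_m=B_m(X_m^\top X_m)^{-1}X_m^\top,\qquad B_m=[b_1,\dots,b_m],$$ $$b_i=\nabla f(x^i)-\nabla f(x^0)-\nabla^2 f(x^0)(x^i-x^0),\quad i=1,\dots,m,$$ and suppose that $A$ is nonsingular. Let $\{x_G^k\}_{k=0,\dots,m}$ be generated by GMRES applied to the linear system $A(x-x^0)=-\nabla f(x^0)$ with initial point $x_G^0=x^0$. Let $\bar g(x)=x-\frac1L\big(A(x-x^0)+\nabla f(x^0)\big)$ and set $\bar x_G^k=\bar g(x_G^k)$. Then $$\bar x_G^k=x^{k+1}\quad\text{and}\quad x_G^k=\hat x^k\qquad\text{for all } k=0,\dots,m.$$ In particular, $\kappa\big((\bar X_G^k)^\top\bar X_G^k\big)\le M^2$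 for each $k=1,\dots,m$, where $\bar X_G^k=[\bar x_G^0-x^0,\dots,\bar x_G^{k-1}-x^0]$.
   Context: $\mathbb{B}_r(x^\star)=\{x:\|x-x^\star\|<r\}$; $\|\cdot\|$ is the Euclidean norm. Define $g(x)=x-\frac1L\nabla f(x)$, $h(x)=g(x)-x=-\frac1L\nabla f(x)$, $g^k=g(x^k)$, $h^k=h(x^k)$. For $1\le k\le m$ let $X_k=[x^1-x^0,\dots,x^k-x^0]$, $H_k=[h^1-h^0,\dots,h^k-h^0]$, $G_k=[g^1-g^0,\dots,g^k-g^0]$, all in $\mathbb{R}^{n\times k}$. $\kappa(A)=\sigma_{\max}(A)/\sigma_{\min}(A)$ is the condition number ($+\infty$ if $\sigma_{\min}(A)=0$). Algorithm AA-R (one restarting cycle): $x^1=g(x^0)$, and for $k=1,\dots,m$, $\alpha^k\in\mathbb{R}^k$ is a solution of $\min_\alpha\|h^0+H_k\alpha\|^2$ and $x^{k+1}=g^0+G_k\alpha^k$. Moreover $\hat x^0:=x^0$ and $\hat x^k:=x^0+X_k\alpha^k$ for $1\le k\le m$. GMRES iterates: for nonsingular $A\in\mathbb{R}^{n\times n}$ and $b\in\mathbb{R}^n$, the $k$-th GMRES iterate for $A(x-x^0)=b$ with initial point $x^0$ is $x_G^k=\mathrm{argmin}_{x\in x^0+\mathcal{K}^k(A,b)}\|A(x-x^0)-b\|^2$, where $\mathcal{K}^k(A,b)=\mathrm{span}\{b,Ab,\dots,A^{k-1}b\}$ and $\mathcal K^0(A,b)=\{0\}$. *)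

(* Defs.v *)
From HB Require Import structures.
From mathcomp Require Import all_boot all_order all_algebra.
From mathcomp Require Import all_classical all_reals all_analysis.

Set Implicit Arguments.
Unset Strict Implicit.
Unset Printing Implicit Defensive.

Import Order.TTheory GRing.Theory Num.Theory.
Import numFieldNormedType.Exports.

Local Open Scope classical_set_scope.
Local Open Scope ring_scope.

(* The library norm on matrices is the max norm, hence this separate definition.
   Differentiability and continuity do not depend on the choice. *)
Definition enorm (R : realType) (n : nat) (v : 'cV[R]_n) : R :=
  Num.sqrt (\sum_(i < n) v i 0 ^+ 2).

Definition eball (R : realType) (n : nat) (c : 'cV[R]_n) (r : R) :
  set 'cV[R]_n := [set x | enorm (x - c) < r].

Definition gradient (R : realType) (n : nat) (f : 'cV[R]_n -> R)
    (x : 'cV[R]_n) : 'cV[R]_n :=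
  \col_(i < n) 'D_(delta_mx i 0) f x.

Definition hessian (R : realType) (n : nat) (f : 'cV[R]_n -> R)
    (x : 'cV[R]_n) : 'M[R]_n :=
  \matrix_(i < n, j < n) 'D_(delta_mx j 0) (fun y => gradient f y i 0) x.

Definition hessian_exists (R : realType) (n : nat) (f : 'cV[R]_n -> R)
    (x : 'cV[R]_n) : Prop :=
  differentiable (gradient f) x.

Definition continuously_differentiable (R : realType) (n : nat)
    (f : 'cV[R]_n -> R) : Prop :=
  (forall x, differentiable f x) /\ continuous (gradient f).

Definition strongly_convex_on (R : realType) (n : nat) (D : set 'cV[R]_n)
    (mu : R) (f : 'cV[R]_n -> R) : Prop :=
  forall x y, D x -> D y -> forall t : R, 0 <= t <= 1 ->
    f (t *: x + (1 - t) *: y) <=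
      t * f x + (1 - t) * f y - mu / 2 * t * (1 - t) * enorm (x - y) ^+ 2.

(* Square matrices only: for a wide matrix, A^T A has zero eigenvalues that are
   not squares of singular values of A. *)
Definition singular_values (R : realType) (k : nat) (A : 'M[R]_k) : set R :=
  [set s | 0 <= s /\ eigenvalue (A^T *m A) (s ^+ 2)].

Definition sigma_max (R : realType) (k : nat) (A : 'M[R]_k) : R :=
  sup (singular_values A).

Definition sigma_min (R : realType) (k : nat) (A : 'M[R]_k) : R :=
  inf (singular_values A).

Definition cond_number (R : realType) (k : nat) (A : 'M[R]_k) : \bar R :=
  if sigma_min A == 0 then +oo%E else (sigma_max A / sigma_min A)%:E.

(* The matrix norm is the spectral norm, i.e. the largest singular value. *)
Definition hessian_lipschitz_on (R : realType) (n : nat) (D : set 'cV[R]_n)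
    (f : 'cV[R]_n -> R) : Prop :=
  (forall x, D x -> hessian_exists f x) /\
  exists rho : R, forall x y, D x -> D y ->
    sigma_max (hessian f x - hessian f y) <= rho * enorm (x - y).

Definition grad_step (R : realType) (n : nat) (L : R) (f : 'cV[R]_n -> R)
    (x : 'cV[R]_n) : 'cV[R]_n :=
  x - L^-1 *: gradient f x.

Definition grad_residual (R : realType) (n : nat) (L : R) (f : 'cV[R]_n -> R)
    (x : 'cV[R]_n) : 'cV[R]_n :=
  grad_step L f x - x.

(* [u 1 - u 0, ..., u k - u 0] *)
Definition diff_mx (R : realType) (n : nat) (u : nat -> 'cV[R]_n) (k : nat) :
    'M[R]_(n, k) :=
  \matrix_(i < n, j < k) (u j.+1 - u 0%N) i 0.

(* [v 0 - c, ..., v (k - 1) - c] *)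
Definition shift_mx (R : realType) (n : nat) (c : 'cV[R]_n)
    (v : nat -> 'cV[R]_n) (k : nat) : 'M[R]_(n, k) :=
  \matrix_(i < n, j < k) (v j - c) i 0.

(* One restarting cycle of AA-R with memory m: only x 0, ..., x m.+1 and
   alpha 1, ..., alpha m are constrained. *)
Definition aar_cycle (R : realType) (n : nat) (L : R) (f : 'cV[R]_n -> R)
    (m : nat) (x : nat -> 'cV[R]_n) (alpha : forall k : nat, 'cV[R]_k) : Prop :=
  let g := fun j => grad_step L f (x j) in
  let h := fun j => grad_residual L f (x j) in
  x 1%N = g 0%N /\
  forall k : nat, (1 <= k <= m)%N ->
    (forall a : 'cV[R]_k,
       enorm (h 0%N + diff_mx h k *m alpha k) ^+ 2 <=
       enorm (h 0%N + diff_mx h k *m a) ^+ 2) /\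
    x k.+1 = g 0%N + diff_mx g k *m alpha k.

Definition aar_hat (R : realType) (n : nat) (x : nat -> 'cV[R]_n)
    (alpha : forall k : nat, 'cV[R]_k) (k : nat) : 'cV[R]_n :=
  if k == 0%N then x 0%N else x 0%N + diff_mx x k *m alpha k.

(* B_m: its columns are the first-order Taylor remainders b_1, ..., b_m of the
   gradient at x 0. *)
Definition taylor_mx (R : realType) (n : nat) (f : 'cV[R]_n -> R)
    (x : nat -> 'cV[R]_n) (m : nat) : 'M[R]_(n, m) :=
  \matrix_(i < n, j < m)
    (gradient f (x j.+1) - gradient f (x 0%N)
       - hessian f (x 0%N) *m (x j.+1 - x 0%N)) i 0.

Definition perturbed_hessian (R : realType) (n : nat) (f : 'cV[R]_n -> R)
    (x : nat -> 'cV[R]_n) (m : nat) : 'M[R]_n :=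
  let X := diff_mx x m in
  hessian f (x 0%N) + taylor_mx f x m *m invmx (X^T *m X) *m X^T.

Definition krylov (R : realType) (n : nat) (A : 'M[R]_n) (b : 'cV[R]_n)
    (k : nat) : {vspace 'cV[R]_n} :=
  <<[seq A ^+ i *m b | i <- iota 0 k]>>%VS.

Definition gmres_iterate (R : realType) (n : nat) (A : 'M[R]_n)
    (b x0 : 'cV[R]_n) (k : nat) (z : 'cV[R]_n) : Prop :=
  z - x0 \in krylov A b k /\
  forall y : 'cV[R]_n, y - x0 \in krylov A b k ->
    enorm (A *m (z - x0) - b) ^+ 2 <= enorm (A *m (y - x0) - b) ^+ 2.

Definition linear_step (R : realType) (n : nat) (L : R) (f : 'cV[R]_n -> R)
    (A : 'M[R]_n) (x0 y : 'cV[R]_n) : 'cV[R]_n :=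
  y - L^-1 *: (A *m (y - x0) + gradient f x0).

(* Main.v *)
Require Import Defs.
From mathcomp Require Import all_boot all_order all_algebra.
From mathcomp Require Import all_classical all_reals all_analysis.
From mathcomp Require Import ring lra.
Import Order.TTheory GRing.Theory Num.Theory.
Import numFieldNormedType.Exports.
Local Open Scope classical_set_scope.
Local Open Scope ring_scope.

(** The gradient is turned into an affine map along the cycle: the correction
    [E_m] is chosen so that [A] satisfies the secant equations
    [A (x^i - x^0) = grad f (x^i) - grad f (x^0)] for all [i <= m]
    ([perturbed_hessian_secant]).  Hence, with [b = - grad f (x^0)], the
    least-squares problem of AA-R at step [k] is, up to the factor [1/L], the
    minimisation of [|A (z - x^0) - b|] over [z] in [x^0 + range X_k], whose
    solution is [\hat x^k], and [x^(k+1)] is the gradient step at [\hat x^k] for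
    the linear model.

    It remains to compare [range X_k] with the Krylov space [K^k(A, b)].  Since
    [x^(k+1) - x^0 = X_k alpha + (b - A X_k alpha) / L], induction shows that the
    first [k] differences lie in [K^k(A, b)].  That space is spanned by [k]
    vectors, while [X_k] has rank [k] because its Gram matrix has a finite
    condition number; so the two spaces are equal ([mem_span_columns]).  GMRES and
    AA-R thus minimise the same function over the same affine space, and as [A] is
    nonsingular the minimiser is unique ([min_residual_uniq]).  The bound on the
    condition numbers follows because [\bar X_G^k] and [X_k] are then the same
    matrix. *)

(** * Euclidean norm and uniqueness of least-squares solutions *)

Lemma enorm_sqE {R : realType} {n : nat} (v : 'cV[R]_n) :
  enorm v ^+ 2 = \sum_(i < n) v i 0 ^+ 2.
Proof. by rewrite sqr_sqrtr // sumr_ge0 // => i _; rewrite sqr_ge0. Qed.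

Lemma enorm_sqZ {R : realType} {n : nat} (c : R) (v : 'cV[R]_n) :
  enorm (c *: v) ^+ 2 = c ^+ 2 * enorm v ^+ 2.
Proof.
rewrite !enorm_sqE mulr_sumr; apply: eq_bigr => i _.
by rewrite mxE exprMn.
Qed.

Lemma enorm_sq_eq0 {R : realType} {n : nat} (v : 'cV[R]_n) :
  enorm v ^+ 2 <= 0 -> v = 0.
Proof.
move=> v0; apply/colP => i; rewrite mxE; apply/eqP.
rewrite -sqrf_eq0 eq_le sqr_ge0 andbT; apply: le_trans v0.
rewrite enorm_sqE (bigD1 i) //= lerDl.
by rewrite sumr_ge0 // => j _; rewrite sqr_ge0.
Qed.

Lemma enorm_parallelogram {R : realType} {n : nat} (u v : 'cV[R]_n) :
  enorm u ^+ 2 + enorm v ^+ 2 =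
    2 * enorm (2^-1 *: (u + v)) ^+ 2 + 2 * enorm (2^-1 *: (u - v)) ^+ 2.
Proof.
rewrite !enorm_sqE !mulr_sumr -!big_split; apply: eq_bigr => i _ /=.
by rewrite !mxE; field.
Qed.

(** By the parallelogram law, the midpoint of two distinct minimisers would do
    strictly better. *)
Lemma min_residual_uniq {R : realType} {n : nat} (A : 'M[R]_n) (b : 'cV[R]_n)
    (V : {vspace 'cV[R]_n}) (u v : 'cV[R]_n) :
  A \in unitmx -> u \in V -> v \in V ->
  (forall w, w \in V -> enorm (A *m u - b) ^+ 2 <= enorm (A *m w - b) ^+ 2) ->
  (forall w, w \in V -> enorm (A *m v - b) ^+ 2 <= enorm (A *m w - b) ^+ 2) ->
  u = v.
Proof.
move=> Au uV vV umin vmin.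
pose w := 2^-1 *: (u + v).
have wV : w \in V by rewrite memvZ // memvD.
have wE : A *m w - b = 2^-1 *: ((A *m u - b) + (A *m v - b)).
  rewrite -scalemxAr mulmxDr; apply/colP => i; rewrite !mxE; by field.
have := enorm_parallelogram (A *m u - b) (A *m v - b).
rewrite -wE; have := umin _ wV; have := vmin _ wV.
set a := enorm _ ^+ 2; set c := enorm (A *m w - b) ^+ 2.
set d := enorm (A *m u - b) ^+ 2; set e := enorm (2^-1 *: _) ^+ 2.
move=> h1 h2 h3.
have : e <= 0 by lra.
move/enorm_sq_eq0/eqP; rewrite scaler_eq0 invr_eq0 pnatr_eq0 /= subr_eq0.
by move=> /eqP/addIr E; rewrite -(mulKmx Au u) E mulKmx.
Qed.

(** * Finite condition numbers *)

(** A singular matrix has the singular value [0], so [sigma_min = 0] and the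
    condition number is infinite. *)
Lemma cond_number_unitmx {R : realType} {k : nat} (K : 'M[R]_k) (c : R) :
  (cond_number K <= c%:E)%E -> K \in unitmx.
Proof.
move=> hc; rewrite unitmxE unitfE; apply/negP => /eqP K0.
suff s0 : sigma_min K = 0 by move: hc; rewrite /cond_number s0 eqxx leNgt ltry.
have S0 : singular_values K 0.
  split=> //; rewrite expr0n /=; apply/eigenvalueP.
  have /det0P[v v0 vK] : \det (K^T *m K) == 0 by rewrite det_mulmx K0 mulr0.
  by exists v => //; rewrite vK scale0r.
have lb0 : lbound (singular_values K) 0 by move=> s [].
apply/eqP; rewrite eq_le ge_inf //=; last by exists 0.
by apply: lb_le_inf => //; exists 0.
Qed.

(** * Column spaces and Krylov spaces *)

Lemma mulmx_sum_col {R : realType} {n k : nat} (X : 'M[R]_(n, k))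
    (a : 'cV[R]_k) :
  X *m a = \sum_(j < k) a j 0 *: col j X.
Proof.
apply/colP => i; rewrite !mxE summxE; apply: eq_bigr => j _.
by rewrite !mxE mulrC.
Qed.

(** A matrix with nonsingular Gram matrix is injective, so its range has
    dimension [k]; if its columns lie in a space of dimension at most [k], they
    must fill it. *)
Lemma mem_span_columns {R : realType} {n k : nat} (X : 'M[R]_(n, k))
    (V : {vspace 'cV[R]_n}) :
  X^T *m X \in unitmx -> (\dim V <= k)%N -> (forall j, col j X \in V) ->
  forall v, v \in V <-> exists a : 'cV[R]_k, v = X *m a.
Proof.
move=> Xu dV colV v.
pose F := linfun (mulmx X) : 'Hom('cV[R]_k, 'cV[R]_n).
have FE a : F a = X *m a by rewrite lfunE.
have Finj : lker F == 0%VS.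
  apply/lker0P => a a'; rewrite !FE => /(congr1 (mulmx X^T)).
  by rewrite !mulmxA => E; rewrite -(mulKmx Xu a) E mulKmx.
have VE : limg F = V.
  apply/eqP; rewrite eqEdim; apply/andP; split.
    apply/subvP => _ /memv_imgP[a _ ->]; rewrite FE mulmx_sum_col.
    by apply: memv_suml => j _; rewrite memvZ.
  rewrite limg_dim_eq; last by rewrite (eqP Finj) capv0.
  by rewrite dimvf /dim /= muln1.
rewrite -VE; split=> [/memv_imgP[a _ ->]|[a ->]]; first by exists a; rewrite FE.
by rewrite -FE memv_img ?memvf.
Qed.

Lemma krylov_mono {R : realType} {n : nat} (A : 'M[R]_n) (b : 'cV[R]_n)
    (j k : nat) :
  (j <= k)%N -> (krylov A b j <= krylov A b k)%VS.
Proof.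
move=> jk; apply: sub_span => _ /mapP[i + ->].
rewrite mem_iota => /andP[_ ij]; apply: map_f; rewrite mem_iota /=.
exact: leq_trans ij jk.
Qed.

Lemma mem_krylov1 {R : realType} {n : nat} (A : 'M[R]_n) (b : 'cV[R]_n)
    (k : nat) :
  b \in krylov A b k.+1.
Proof.
apply: memv_span; apply/mapP; exists 0%N; first by rewrite mem_iota.
by rewrite expr0 mul1mx.
Qed.

Lemma mulmx_krylov {R : realType} {n : nat} (A : 'M[R]_n) (b v : 'cV[R]_n)
    (k : nat) :
  v \in krylov A b k -> A *m v \in krylov A b k.+1.
Proof.
pose F := linfun (mulmx A) : 'Hom('cV[R]_n, 'cV[R]_n).
have FE u : F u = A *m u by rewrite lfunE.
rewrite -FE memv_preim; apply: subvP; apply/span_subvP => _ /mapP[i + ->].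
rewrite mem_iota => /andP[_ ik]; rewrite -memv_preim FE.
apply: memv_span; apply/mapP; exists i.+1; first by rewrite mem_iota.
by rewrite mulmxA exprS.
Qed.

Lemma dim_krylov {R : realType} {n : nat} (A : 'M[R]_n) (b : 'cV[R]_n)
    (k : nat) :
  (\dim (krylov A b k) <= k)%N.
Proof. by apply: leq_trans (dim_span _) _; rewrite size_map size_iota. Qed.

(** * Secant equations and the linear model *)

Lemma col_diff_mx {R : realType} {n : nat} (u : nat -> 'cV[R]_n) (k : nat)
    (j : 'I_k) :
  col j (diff_mx u k) = u j.+1 - u 0%N.
Proof. by apply/colP => i; rewrite !mxE. Qed.

(** [E_m X_m = B_m (X_m^T X_m)^-1 X_m^T X_m = B_m], and the columns of [B_m] are
    exactly what the Hessian misses in the secant equations. *)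
Lemma perturbed_hessian_secant {R : realType} {n : nat} (f : 'cV[R]_n -> R)
    (x : nat -> 'cV[R]_n) (m j : nat) :
  (diff_mx x m)^T *m diff_mx x m \in unitmx -> (j < m)%N ->
  perturbed_hessian f x m *m (x j.+1 - x 0%N) =
    gradient f (x j.+1) - gradient f (x 0%N).
Proof.
move=> Xu jm.
(* Both sides become column j of an identity between n by m matrices. *)
have -> : x j.+1 - x 0%N = col (Ordinal jm) (diff_mx x m) by rewrite col_diff_mx.
rewrite colE mulmxA -colE /perturbed_hessian mulmxDl -!mulmxA mulVmx // mulmx1.
rewrite linearD /= [col _ (_ *m _)]colE -mulmxA -colE col_diff_mx /=.
have -> : col (Ordinal jm) (taylor_mx f x m) =
    gradient f (x j.+1) - gradient f (x 0%N)
      - hessian f (x 0%N) *m (x j.+1 - x 0%N).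
  by apply/colP => i; rewrite !mxE.
by rewrite addrC subrK.
Qed.

Lemma grad_residualE {R : realType} {n : nat} (L : R) (f : 'cV[R]_n -> R)
    (y : 'cV[R]_n) :
  grad_residual L f y = - (L^-1 *: gradient f y).
Proof. by rewrite /grad_residual /grad_step addrAC subrr add0r. Qed.

Lemma diff_mx_residual {R : realType} {n : nat} (L : R) (f : 'cV[R]_n -> R)
    (A : 'M[R]_n) (x : nat -> 'cV[R]_n) (k : nat) :
  (forall j, (j < k)%N ->
     A *m (x j.+1 - x 0%N) = gradient f (x j.+1) - gradient f (x 0%N)) ->
  diff_mx (fun j => grad_residual L f (x j)) k = - (L^-1 *: (A *m diff_mx x k)).
Proof.
move=> sec; apply/matrixP => i j.
have := congr1 (fun v : 'cV_n => v i 0) (sec j (ltn_ord j)).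
rewrite -(col_diff_mx x) colE mulmxA -colE => E.
rewrite mxE !grad_residualE [RHS]mxE.
have -> : (L^-1 *: (A *m diff_mx x k)) i j = L^-1 * (A *m diff_mx x k) i j.
  by rewrite mxE.
move: E; rewrite [LHS]mxE => ->; rewrite !mxE; by ring.
Qed.

Lemma diff_mx_step {R : realType} {n : nat} (L : R) (f : 'cV[R]_n -> R)
    (x : nat -> 'cV[R]_n) (k : nat) :
  diff_mx (fun j => grad_step L f (x j)) k =
    diff_mx x k + diff_mx (fun j => grad_residual L f (x j)) k.
Proof. by apply/matrixP => i j; rewrite /grad_residual !mxE; ring. Qed.

(** Under the secant equations both objects that AA-R forms from the nonlinear
    gradient are those of the linear model at [x 0 + X_k a]: the combined
    residual [h^0 + H_k a] and the combined step [g^0 + G_k a]. *)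
Lemma combined_residualE {R : realType} {n : nat} (L : R) (f : 'cV[R]_n -> R)
    (A : 'M[R]_n) (x : nat -> 'cV[R]_n) (k : nat) (a : 'cV[R]_k) :
  (forall j, (j < k)%N ->
     A *m (x j.+1 - x 0%N) = gradient f (x j.+1) - gradient f (x 0%N)) ->
  grad_residual L f (x 0%N)
      + diff_mx (fun j => grad_residual L f (x j)) k *m a =
    - L^-1 *: (A *m (diff_mx x k *m a) - - gradient f (x 0%N)).
Proof.
move=> sec; rewrite (diff_mx_residual _ _ _ _ _ sec) grad_residualE opprK.
by rewrite mulNmx -scalemxAl mulmxA addrC -opprD -scalerDr scaleNr.
Qed.

Lemma combined_stepE {R : realType} {n : nat} (L : R) (f : 'cV[R]_n -> R)
    (A : 'M[R]_n) (x : nat -> 'cV[R]_n) (k : nat) (a : 'cV[R]_k) :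
  (forall j, (j < k)%N ->
     A *m (x j.+1 - x 0%N) = gradient f (x j.+1) - gradient f (x 0%N)) ->
  grad_step L f (x 0%N) + diff_mx (fun j => grad_step L f (x j)) k *m a =
    linear_step L f A (x 0%N) (x 0%N + diff_mx x k *m a).
Proof.
move=> sec; rewrite diff_mx_step mulmxDl.
have -> : grad_step L f (x 0%N) = x 0%N + grad_residual L f (x 0%N).
  by rewrite /grad_residual addrC subrK.
rewrite addrACA (combined_residualE _ _ _ _ _ _ sec) opprK scaleNr /linear_step.
by rewrite [x 0%N + _ - x 0%N]addrC addKr.
Qed.

(** * Identification of the two methods *)

(** The step at [x 0 + X_k a] adds to [X_k a] a multiple of the linear residual
    [b - A X_k a], which is one Krylov dimension further. *)
Lemma aar_sub_krylov {R : realType} {n : nat} (L : R) (f : 'cV[R]_n -> R)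
    (A : 'M[R]_n) (x : nat -> 'cV[R]_n) (alpha : forall k : nat, 'cV[R]_k)
    (m : nat) :
  (forall j, (j < m)%N ->
     A *m (x j.+1 - x 0%N) = gradient f (x j.+1) - gradient f (x 0%N)) ->
  aar_cycle L f m x alpha ->
  forall k, (k < m)%N ->
    x k.+1 - x 0%N \in krylov A (- gradient f (x 0%N)) k.+1.
Proof.
move=> sec [x1 step] k; elim/ltn_ind: k => -[_ _|k IH km].
  rewrite x1 /grad_step addrAC subrr add0r -scalerN memvZ //.
  exact: mem_krylov1.
have [_ ->] := step k.+1 (ltnW km : (1 <= k.+1 <= m)%N).
have sec' j : (j < k.+1)%N ->
    A *m (x j.+1 - x 0%N) = gradient f (x j.+1) - gradient f (x 0%N).
  by move=> jk; apply: sec; apply: ltn_trans km.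
rewrite (combined_stepE _ _ _ _ _ _ sec') /linear_step.
have Xa : diff_mx x k.+1 *m alpha k.+1
    \in krylov A (- gradient f (x 0%N)) k.+1.
  rewrite mulmx_sum_col; apply: memv_suml => j _; rewrite memvZ // col_diff_mx.
  apply: subvP (IH j (ltn_ord j) (ltn_trans (ltn_ord j) km)).
  exact/krylov_mono/ltn_ord.
rewrite [x 0%N + _ - x 0%N]addrC addKr addrAC [x 0%N + _ - x 0%N]addrC addKr.
apply: memvB; first exact: subvP (krylov_mono _ _ _ _ (leqnSn _)) _ Xa.
apply/memvZ/memvD; first exact: mulmx_krylov.
by rewrite -memvN mem_krylov1.
Qed.

Theorem proposition3p8 (R : realType) (n : nat) (f : 'cV[R]_n -> R)
    (xstar : 'cV[R]_n) (r L mu M : R) (m : nat)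
    (x : nat -> 'cV[R]_n) (alpha : forall k : nat, 'cV[R]_k)
    (xG : nat -> 'cV[R]_n)
    (A := perturbed_hessian f x m)
    (xGbar := fun k : nat => linear_step L f A (x 0%N) (xG k)) :
  continuously_differentiable f ->
  0 < r ->
  gradient f xstar = 0 ->
  0 < L ->
  (forall y z, enorm (gradient f y - gradient f z) <= L * enorm (y - z)) ->
  0 < mu ->
  strongly_convex_on (eball xstar r) mu f ->
  hessian_lipschitz_on (eball xstar r) f ->
  (1 <= m)%N ->
  hessian_exists f (x 0%N) ->
  aar_cycle L f m x alpha ->
  0 < M ->
  (forall k : nat, (1 <= k <= m)%N ->
     (cond_number ((diff_mx x k)^T *m diff_mx x k) <= (M ^+ 2)%:E)%E) ->
  A \in unitmx ->
  (forall k : nat, (k <= m)%N ->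
     gmres_iterate A (- gradient f (x 0%N)) (x 0%N) k (xG k)) ->
  (forall k : nat, (k <= m)%N ->
     xGbar k = x k.+1 /\ xG k = aar_hat x alpha k) /\
  (forall k : nat, (1 <= k <= m)%N ->
     (cond_number ((shift_mx (x 0%N) xGbar k)^T *m shift_mx (x 0%N) xGbar k)
        <= (M ^+ 2)%:E)%E).
Proof.
move=> _ _ _ L0 _ _ _ _ m1 _ cycle _ cond Au gmres.
have gram k : (1 <= k <= m)%N -> (diff_mx x k)^T *m diff_mx x k \in unitmx.
  by move=> /cond /cond_number_unitmx.
have sec j : (j < m)%N ->
    A *m (x j.+1 - x 0%N) = gradient f (x j.+1) - gradient f (x 0%N).
  by apply: perturbed_hessian_secant; apply: gram; rewrite m1 leqnn.
have [x1 step] := cycle.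
have iter k : (k <= m)%N -> xGbar k = x k.+1 /\ xG k = aar_hat x alpha k.
  case: k => [|k] km.
    have [+ _] := gmres 0%N km; rewrite /krylov span_nil memv0 subr_eq0.
    move=> /eqP xG0; rewrite /xGbar /linear_step /aar_hat xG0 subrr mulmx0 add0r.
    by rewrite x1.
  have [opt xS] := step k.+1 km.
  have seck j : (j < k.+1)%N ->
      A *m (x j.+1 - x 0%N) = gradient f (x j.+1) - gradient f (x 0%N).
    by move=> jk; apply: sec; apply: leq_trans jk km.
  have colK j : col j (diff_mx x k.+1) \in krylov A (- gradient f (x 0%N)) k.+1.
    rewrite col_diff_mx; have jm := leq_trans (ltn_ord j) km.
    apply: subvP (aar_sub_krylov _ _ _ _ _ _ sec cycle j jm).
    exact/krylov_mono/ltn_ord.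
  have rangeE := mem_span_columns (diff_mx x k.+1)
    (krylov A (- gradient f (x 0%N)) k.+1) (gram k.+1 km) (dim_krylov _ _ _) colK.
  have xGE : xG k.+1 = aar_hat x alpha k.+1.
    have [zV zmin] := gmres k.+1 km.
    rewrite /aar_hat /=; apply: (addIr (- x 0%N)); rewrite [RHS]addrAC subrr add0r.
    apply: (min_residual_uniq A (- gradient f (x 0%N)) _ _ _ Au zV).
    - by apply/rangeE; exists (alpha k.+1).
    - by move=> w wV; have := zmin (w + x 0%N); rewrite addrK; apply.
    (* The objective of AA-R is that of GMRES multiplied by L^-2 > 0. *)
    - move=> _ /rangeE[a ->]; have := opt a.
      rewrite !(combined_residualE _ _ _ _ _ _ seck) !enorm_sqZ ler_pM2l //.
      by rewrite exprn_even_gt0 //= oppr_eq0 invr_eq0 gt_eqF.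
  split=> //.
  by rewrite xS (combined_stepE _ _ _ _ _ _ seck) /xGbar xGE.
split=> // k /[dup] /cond + /andP[_ km].
suff -> : shift_mx (x 0%N) xGbar k = diff_mx x k by [].
apply/matrixP => i j; rewrite [LHS]mxE [RHS]mxE.
by have [-> _] := iter j (ltnW (leq_trans (ltn_ord j) km)).
Qed.
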